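(* Let $X$ be a $T_0$ space. The following conditions are equivalent: (1) $X$ is $\omega^\ast$-well-filtered. (2) The Smyth power space $P_S(X)$ is an $\omega^\ast$-$d$-space. (3) The Smyth power space $P_S(X)$ is $\omega^\ast$-well-filtered.
   Context: For a $T_0$ space $X$, the specialization order is $x\le y$ iff $x\in\overline{\{y\}}$; all order notions on a $T_0$ space refer to it. A subset is saturated if it is an upper set (equivalently, an intersection of open sets). $\mathsf{K}(X)$ is the set of all nonempty compact saturated subsets of $X$. The Smyth power space $P_S(X)$ is the set $\mathsf K(X)$ with the topology having the sets $\Box U=\{K\in\mathsf K(X): K\subseteq U\}$, $U$ open in $X$, as a base. It is $T_0$, and its specialization order is the Smyth order: $K_1\sqsubseteq K_2$ iff $K_2\subseteq K_1$. A nonempty subset $D$ of a poset is countably-directed if every nonempty countable subset of $D$ has an upper bound in $D$. A family $\mathcal K\subseteq\mathsf K(X)$ is countable-filtered if it is countably-directed in the Smyth order, i.e. it is nonempty and every nonempty countable subfamily $\mathcal K_0\subseteq\mathcal K$ admits $K\in\mathcal K$ with $K\subseteq\bigcap\mathcal K_0$. A $T_0$ space $X$ is $\omega^\ast$-well-filtered if for every countable-filtered family $\{K_i:i\in I\}\subseteq\mathsf K(X)$ and every open $U\subseteq X$, $\bigcap_{i\in I}K_i\subseteq U$ implies $K_j\subseteq U$ for some $j\in I$. A $T_0$ space $X$ is an $\omega^\ast$-$d$-space if every countably-directed subset $D$ of $X$ has a supremum, and for every open $U$, $\bigvee D\in U$ implies $D\cap U\ne\emptyset$. *)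

(* Defs.v *)
From HB Require Import structures.
From mathcomp Require Import all_boot all_order all_algebra.
From mathcomp Require Import all_classical.
From mathcomp Require Import topology.

Set Implicit Arguments.
Unset Strict Implicit.
Unset Printing Implicit Defensive.

Local Open Scope classical_set_scope.

Section OrderNotions.
Context {T : Type} (le : T -> T -> Prop).

(* [le] is Prop-valued and no order axioms are bundled: it is instantiated
   below with the specialization order of a topological space and with the
   Smyth order. *)
Definition is_upper_bound (D : set T) (u : T) := forall x, D x -> le x u.

Definition is_supremum (D : set T) (s : T) :=
  is_upper_bound D s /\ forall u, is_upper_bound D u -> le s u.

Definition countably_directed (D : set T) :=
  D !=set0 /\
  forall C : set T, C `<=` D -> C !=set0 -> countable C ->
    exists2 u, D u & is_upper_bound C u.

End OrderNotions.

Definition spec_le {X : topologicalType} (x y : X) : Prop :=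
  closure [set y] x.

Definition saturated {X : topologicalType} (A : set X) : Prop :=
  forall x y, A x -> spec_le x y -> A y.

Definition compact_saturated (X : topologicalType) : set (set X) :=
  [set K | [/\ K !=set0, compact K & saturated K]].

Definition smyth_power (X : topologicalType) : Type :=
  set_type (@compact_saturated X).

HB.instance Definition _ (X : topologicalType) :=
  Choice.copy (smyth_power X) (set_type (@compact_saturated X)).

Definition smyth_set {X : topologicalType} (K : smyth_power X) : set X :=
  set_val K.

Coercion smyth_set : smyth_power >-> set.

Definition smyth_box {X : topologicalType} (U : set X) : set (smyth_power X) :=
  [set K : smyth_power X | (K : set X) `<=` U].

Definition smyth_le {X : topologicalType} (K1 K2 : smyth_power X) : Prop :=
  (K2 : set X) `<=` (K1 : set X).

Section SmythTopology.
Context {X : topologicalType}.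

Let box_cover : \bigcup_(U in @open X) smyth_box U = setT.
Proof. by apply/seteqP; split=> // K _; exists setT => //; exact: openT. Qed.

Let box_join (U V : set X) (K : smyth_power X) :
  open U -> open V -> smyth_box U K -> smyth_box V K ->
  exists W, [/\ open W, smyth_box W K &
    smyth_box W `<=` smyth_box U `&` smyth_box V].
Proof.
move=> oU oV KU KV; exists (U `&` V); split; first exact: openI.
- by move=> x Kx; split; [exact: KU|exact: KV].
- by move=> L LUV; split=> x /LUV [].
Qed.

HB.instance Definition _ :=
  @isBaseTopological.Build (smyth_power X) (set X) open smyth_box
    box_cover box_join.

Lemma smyth_openP (W : set (smyth_power X)) :
  open W <-> exists2 F : set (set X), F `<=` open &
    \bigcup_(U in F) smyth_box U = W.
Proof. by []. Qed.

Lemma smyth_box_open (U : set X) : open U -> open (smyth_box U).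
Proof.
move=> oU; apply/smyth_openP; exists [set U]; first by move=> _ ->.
by rewrite bigcup_set1.
Qed.

End SmythTopology.

Lemma spec_leP {X : topologicalType} (x y : X) :
  spec_le x y <-> forall U : set X, open U -> U x -> U y.
Proof.
split=> [xy U oU Ux|xy B].
  have [|z [-> //]] := xy U.
  by rewrite nbhsE; exists U.
by rewrite nbhsE => -[U [oU Ux] UB]; exists y; split=> //; exact/UB/(xy U).
Qed.

Lemma spec_le_smyth {X : topologicalType} (K1 K2 : smyth_power X) :
  spec_le K1 K2 <-> smyth_le K1 K2.
Proof.
rewrite spec_leP; split=> [K12 y K2y|K21 W /smyth_openP[F Fo <-] [U FU K1U]].
  have /set_mem [_ _ satK1] := valP K1.
  apply: contrapT => nK1y.
  pose U := ~` closure [set y].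
  have oU : open U by exact/closed_openC/closed_closure.
  have K1U : smyth_box U K1 by move=> x K1x xy; exact/nK1y/(satK1 x).
  apply: (K12 _ (smyth_box_open oU) K1U _ K2y).
  exact: subset_closure.
by exists U => // x /K21 /K1U.
Qed.

Lemma smyth_power_T0 (X : topologicalType) : kolmogorov_space (smyth_power X).
Proof.
move=> K L KL.
have key (M N : smyth_power X) : ~ smyth_le M N ->
    exists A : set (smyth_power X), A \in nbhs M /\ N \in ~` A.
  move=> MN; apply: contrapT => nA; apply/MN/spec_le_smyth/spec_leP => U oU UM.
  apply: contrapT => UN; apply: nA; exists U; rewrite !inE; split=> //.
  exact: open_nbhs_nbhs.
have [LK|/key [A ?]] := pselect (smyth_le K L); last by exists A; left.
have [LK'|/key [A ?]] := pselect (smyth_le L K); last by exists A; right.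
by case/eqP: KL; apply: val_inj; apply/seteqP; split.
Qed.

Definition countable_filtered {X : topologicalType}
    (F : set (smyth_power X)) : Prop :=
  countably_directed smyth_le F.

Definition omega_star_well_filtered (X : topologicalType) : Prop :=
  kolmogorov_space X /\
  forall (F : set (smyth_power X)) (U : set X),
    countable_filtered F -> open U ->
    \bigcap_(K in F) (K : set X) `<=` U ->
    exists2 K, F K & (K : set X) `<=` U.

(* Suprema are unique in a T0 space, so [s] below is the supremum of [D]. *)
Definition omega_star_d_space (X : topologicalType) : Prop :=
  kolmogorov_space X /\
  forall D : set X, countably_directed spec_le D ->
    exists2 s, is_supremum spec_le D s &
      forall U : set X, open U -> U s -> D `&` U !=set0.

(* Main.v *)
Require Import Defs.
From mathcomp Require Import all_boot all_classical topology.

(** The step (1) => (3) uses the topological Rudin lemma: if no member of a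
    family of compact sets of [P_S(X)] is contained in an open set [W], then [W]
    is contained in a maximal open [M] with the same property.  For a
    countable-filtered family of compact saturated [Q], the unions of the
    [Q `\` M] form a countable-filtered family in [X]; let [K] be its
    intersection.  Well-filteredness of [X] makes [K] compact saturated and puts
    it outside [M]; maximality of [M] makes [K] a subset of every
    point of [P_S(X)] outside [M], and hence an element of every [Q].
    So [K] lies in the intersection of the [Q] but not in [W].  The step (3) => (2) holds in any space, with the sets of
    specialization-upper bounds of points as compact saturated sets.  *)

Set Implicit Arguments.
Unset Strict Implicit.
Unset Printing Implicit Defensive.

Local Open Scope classical_set_scope.

Lemma countably_directed_image (S T : Type) (leS : S -> S -> Prop)
    (leT : T -> T -> Prop) (f : S -> T) (D : set S) :
  (forall x y, D x -> D y -> leS x y -> leT (f x) (f y)) ->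
  countably_directed leS D -> countably_directed leT (f @` D).
Proof.
move=> fmono [[d Dd] dirD]; split; first by exists (f d), d.
move=> C CD [c Cc] cntC.
(* A countable subset of the image is lifted to a countable set of preimages in [D]; [d] is a dummy
   value off [C]. *)
have /choice[g gP] t : exists s, C t -> D s /\ f s = t.
  have [/CD[s Ds <-]|nCt] := pselect (C t); first by exists s.
  by exists d.
have [_ [t Ct <-]|||u Du ub] := dirD (g @` C).
- by have [] := gP _ Ct.
- by exists (g c), c.
- exact: sub_countable (card_image_le _ _) cntC.
exists (f u); first by exists u.
move=> t Ct; have [Dg <-] := gP _ Ct.
by apply: fmono => //; apply: ub; exists t.
Qed.

(* The library's [compact_cover] requires a pointed space. *)
Lemma compact_directedP (X : topologicalType) (A : set X) :
  compact A <->
  forall O : set (set X), O !=set0 -> O `<=` open ->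
    (forall U V, O U -> O V -> exists2 W, O W & U `|` V `<=` W) ->
    A `<=` \bigcup_(U in O) U -> exists2 U, O U & A `<=` U.
Proof.
split=> [cA O [U0 OU0] Oo Odir AO|cA F PF FA].
  apply: contrapT => nA.
  (* If no member of [O] contains [A], the traces on [A] of their complements generate a proper
     filter, whose cluster point in [A] cannot lie in any member of [O]. *)
  have PF : ProperFilter (filter_from O (fun U => A `\` U)).
    apply: filter_from_proper.
      apply: filter_from_filter; first by exists U0.
      move=> U V OU OV; have [W OW UVW] := Odir _ _ OU OV; exists W => // x.
      by move=> [Ax nWx]; split; split=> // ?; apply/nWx/UVW; [left|right].
    move=> U OU; apply: contrapT => AU; apply: nA; exists U => // x Ax.
    by apply: contrapT => nUx; apply: AU; exists x.
  have [|x [Ax clx]] := cA _ PF; first by exists U0 => // x [].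
  have [U OU Ux] := AO _ Ax.
  have [||y [[_ nUy] Uy]] := clx (A `\` U) U; last exact: nUy.
    by exists U.
  by apply: open_nbhs_nbhs; split=> //; exact: Oo.
apply: contrapT => ncl.
(* A point of [A] at which [F] does not cluster has an open neighbourhood whose complement is in
   [F]; such open sets form a directed family. *)
have [|U []||x Ax|U [_ FU] AU] := cA [set U | open U /\ F (~` U)].
- by exists set0; split; [exact: open0|rewrite setC0; exact: filterT].
- by [].
- move=> U V [oU FU] [oV FV]; exists (U `|` V) => //.
  by split; [exact: openU|rewrite setCU; exact: filterI].
- apply: contrapT => nx; apply: ncl; exists x; split=> // B N FB.
  rewrite nbhsE => -[U [oU Ux] UN]; apply: contrapT => BN; apply: nx.
  exists U => //; split=> //; apply: filterS FB => y By Uy.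
  by apply: BN; exists y; split=> //; exact: UN.
- apply: (@filter_not_empty _ F) => //.
  by apply: filterS (filterI FA FU) => x [/AU].
Qed.

Lemma spec_le_refl (X : topologicalType) (x : X) : spec_le x x.
Proof. exact/spec_leP. Qed.

Lemma spec_le_trans (X : topologicalType) (x y z : X) :
  spec_le x y -> spec_le y z -> spec_le x z.
Proof.
move=> /spec_leP xy /spec_leP yz; apply/spec_leP => U oU /xy/yz; exact.
Qed.

Lemma open_saturated (X : topologicalType) (U : set X) : open U -> saturated U.
Proof. by move=> oU x y Ux /spec_leP; exact. Qed.

Lemma smyth_setP (X : topologicalType) (K : smyth_power X) :
  compact_saturated K.
Proof. exact: set_valP. Qed.

Lemma smyth_power_exists (X : topologicalType) (A : set X) :
  compact_saturated A -> exists K : smyth_power X, K = A :> set X.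
Proof. by move=> csA; exists (SigSub (mem_set csA)). Qed.

Lemma compact_saturated_up (X : topologicalType) (x : X) :
  compact_saturated [set y | spec_le x y].
Proof.
split; first by exists x; exact: spec_le_refl.
  apply/compact_directedP => O _ Oo _ /(_ x (@spec_le_refl _ x)) [U OU Ux].
  by exists U => // y xy; exact: open_saturated (Oo _ OU) _ _ Ux xy.
by move=> y z /= xy yz; exact: spec_le_trans xy yz.
Qed.

(** Well-filteredness, applied to the sets [up d] and the complement of the closure of [D], yields
    an upper bound of [D] in that closure. Every open set around it meets [D], so it lies below all
    upper bounds. *)
Lemma omega_star_well_filtered_d_space (X : topologicalType) :
  omega_star_well_filtered X -> omega_star_d_space X.
Proof.
move=> [T0X wfX]; split=> // D dirD.
have /choice[up upE] :=
  fun x : X => smyth_power_exists (compact_saturated_up x).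
have cfD : countable_filtered (up @` D).
  apply: countably_directed_image dirD => x y _ _ xy z.
  by rewrite !upE; exact: spec_le_trans.
have [s [ubs cls]] :
    exists s, is_upper_bound spec_le D s /\ closure D s.
  apply: contrapT => ns.
  have [|z Dz|_ [d Dd <-]] := wfX _ (~` closure D) cfD.
  - exact/closed_openC/closed_closure.
  - move=> clz; apply: ns; exists z; split=> // d Dd.
    by have := Dz (up d); rewrite upE; apply; exists d.
  rewrite upE => /(_ d (@spec_le_refl _ d)); apply.
  exact: subset_closure.
exists s => [|U oU Us]; last by apply: cls; exact: open_nbhs_nbhs.
split=> // u ubu; apply/spec_leP => U oU Us.
have [|d [Dd Ud]] := cls U; first exact: open_nbhs_nbhs.
exact: open_saturated Ud (ubu _ Dd).
Qed.

(** Well-filteredness with the empty open set gives nonemptiness; with the union of a directed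
    cover, it passes to one compact member of [F]. *)
Lemma omega_star_well_filtered_bigcap (X : topologicalType)
    (F : set (smyth_power X)) :
  omega_star_well_filtered X -> countable_filtered F ->
  compact_saturated (\bigcap_(K in F) (K : set X)).
Proof.
move=> [_ wfX] cfF; split.
- apply: contrapT => F0.
  have [||K _ K0] := wfX F set0 cfF; first exact: open0.
    by move=> x Fx; apply: F0; exists x.
  by have [[x /K0]] := smyth_setP K.
- apply/compact_directedP => O O0 Oo Odir FO.
  have [|K FK KO] := wfX F _ cfF _ FO; first exact: bigcup_open.
  have [_ /compact_directedP cK _] := smyth_setP K.
  have [U OU KU] := cK O O0 Oo Odir KO.
  by exists U => // x /(_ K FK) /KU.
- move=> x y Fx xy K FK; have [_ _ satK] := smyth_setP K.
  exact: satK (Fx K FK) xy.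
Qed.

Lemma topological_rudin (Y : topologicalType) (F : set (set Y)) (W : set Y) :
  F `<=` @compact Y -> open W -> (forall Q, F Q -> ~ Q `<=` W) ->
  exists M, [/\ open M, W `<=` M, forall Q, F Q -> ~ Q `<=` M &
    forall N, open N -> M `<=` N -> (forall Q, F Q -> ~ Q `<=` N) -> N `<=` M].
Proof.
move=> Fc oW FW.
(* Building [W] into the predicate makes the empty chain admissible. For a nonempty chain,
   compactness of [Q] reduces the union to one member. *)
have [C CP Ctot|M [[oM FM] maxM]] := @Zorn_bigcup Y
    [set V | open V /\ forall Q, F Q -> ~ Q `<=` W `|` V].
  split=> [|Q FQ]; first by apply: bigcup_open => V /CP[].
  have [->|/set0P C0] := eqVneq C set0.
    by rewrite bigcup_set0 setU0; exact: FW.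
  move=> QC; have /compact_directedP cQ := Fc _ FQ.
  have [||||_ [V CV <-]] := cQ ((fun V => W `|` V) @` C).
  - by have [V CV] := C0; exists (W `|` V), V.
  - by move=> _ [V /CP[oV _] <-]; exact: openU.
  - move=> _ _ [U CU <-] [V CV <-].
    have [UV|VU] := Ctot _ _ CU CV.
      exists (W `|` V); first by exists V.
      by move=> x [[]|//]; [left|move=> /UV; right].
    exists (W `|` U); first by exists U.
    by move=> x [//|[]]; [left|move=> /VU; right].
  - move=> x /QC[Wx|[V CV Vx]].
      by have [V CV] := C0; exists (W `|` V); [exists V|left].
    by exists (W `|` V); [exists V|right].
  by have [_] := CP _ CV; exact.
exists (W `|` M); split=> //; first exact: openU.
move=> N oN MN FN x Nx; right; apply: contrapT => nMx.
apply: (maxM N).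
  by split=> [y My|/(_ x Nx)//]; apply: MN; right.
split=> // Q FQ QN; apply: (FN Q FQ) => y /QN[Wy|//].
by apply: MN; left.
Qed.

(** Compactness is used twice: each [L] outside [M] fits into one [U] of a directed cover, so the
    open sets [M] together with [smyth_box U] form a directed cover of [Q]. *)
Lemma compact_saturated_bigcupD (X : topologicalType)
    (Q : smyth_power (smyth_power X)) (M : set (smyth_power X)) :
  open M -> ~ (Q : set (smyth_power X)) `<=` M ->
  compact_saturated (\bigcup_(L in (Q : set (smyth_power X)) `\` M) (L : set X)).
Proof.
move=> oM QM; have [_ /compact_directedP cQ _] := smyth_setP Q; split.
- apply: contrapT => Q0; apply: QM => L QL; apply: contrapT => nML.
  by have [[x Lx] _ _] := smyth_setP L; apply: Q0; exists x, L.
- apply/compact_directedP => O O0 Oo Odir QO.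
  have [||||_ [U OU <-] QU] := cQ ((fun U => M `|` smyth_box U) @` O).
  + by have [U OU] := O0; exists (M `|` smyth_box U), U.
  + by move=> _ [U /Oo oU <-]; apply: openU => //; exact: smyth_box_open.
  + move=> _ _ [U OU <-] [V OV <-]; have [W OW UVW] := Odir _ _ OU OV.
    exists (M `|` smyth_box W); first by exists W.
    move=> L [[ML|LU]|[ML|LV]]; [by left|right|by left|right].
      by move=> x Lx; apply: UVW; left; exact: LU.
    by move=> x Lx; apply: UVW; right; exact: LV.
  + move=> L QL; have [ML|nML] := pselect (M L).
      by have [U OU] := O0; exists (M `|` smyth_box U); [exists U|left].
    have [_ /compact_directedP cL _] := smyth_setP L.
    have [|U OU LU] := cL O O0 Oo Odir.
      by move=> x Lx; apply: QO; exists L.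
    by exists (M `|` smyth_box U); [exists U|right].
  + by exists U => // x [L [/QU[//|LU] _]]; exact: LU.
- move=> x y [L QL Lx] xy; exists L => //.
  by have [_ _ satL] := smyth_setP L; exact: satL Lx xy.
Qed.

Lemma omega_star_well_filtered_smyth (X : topologicalType) :
  omega_star_well_filtered X -> omega_star_well_filtered (smyth_power X).
Proof.
move=> wfX; split; first exact: smyth_power_T0.
move=> F W cfF oW FW; apply: contrapT => nW.
have [_ [Q FQ <-]||_ [Q FQ <-] QW|M [oM WM FM maxM]] :=
    @topological_rudin _ (smyth_set @` F) W.
- by have [] := smyth_setP Q.
- exact: oW.
- by apply: nW; exists Q.
have {}FM Q : F Q -> ~ (Q : set (smyth_power X)) `<=` M.
  by move=> FQ; apply: FM; exists Q.
have [Q0 FQ0] := cfF.1.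
have [K0 _] := smyth_power_exists (compact_saturated_bigcupD oM (FM _ FQ0)).
have /choice[cup cupE] Q : exists K : smyth_power X, F Q ->
    K = \bigcup_(L in (Q : set (smyth_power X)) `\` M) (L : set X) :> set X.
  have [FQ|nFQ] := pselect (F Q); last by exists K0.
  have [K KE] := smyth_power_exists (compact_saturated_bigcupD oM (FM _ FQ)).
  by exists K.
have cfcup : countable_filtered (cup @` F).
  apply: countably_directed_image cfF => Q R FQ FR QR x.
  by rewrite !cupE// => -[L [/QR QL nML] Lx]; exists L.
have [K KE] := smyth_power_exists (omega_star_well_filtered_bigcap wfX cfcup).
have nMK : ~ M K.
  move=> MK; have /smyth_openP[B Bo BM] := oM.
  have [U BU KU] : (\bigcup_(U in B) smyth_box U) K by rewrite BM.
  (* Some [cup Q] lies in [U], so the members of [Q] outside [M] lie in [smyth_box U], hence in [M]: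
     a contradiction. *)
  have [||_ [Q FQ <-] QU] := wfX.2 _ U cfcup; first exact: Bo.
    by rewrite -KE.
  apply: (FM Q FQ) => L QL; apply: contrapT => nML; apply: (nML).
  rewrite -BM; exists U => // x Lx; apply: QU.
  by rewrite cupE//; exists L.
have leK (L : smyth_power X) : ~ M L -> smyth_le L K.
  move=> nML x Kx; apply: contrapT => nLx; apply: nML.
  have nclP (N : smyth_power X) :
      smyth_box (~` closure [set x]) N <-> ~ (N : set X) x.
    split=> [Nx /Nx|nNx y Ny yx]; first by apply; exact: subset_closure.
    by have [_ _ satN] := smyth_setP N; exact/nNx/(satN y).
  (* If [x] were in [K] but not in [L], adding to [M] the sets that miss [x] would add [L]. Yet no
     [Q] fits into this larger open set, since [x] is in [cup Q]. *)
  apply: (maxM (M `|` smyth_box (~` closure [set x]))).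
  - apply: openU => //; apply: smyth_box_open.
    exact/closed_openC/closed_closure.
  - by move=> N; left.
  - move=> _ [Q FQ <-] Qx.
    have : (cup Q : set X) x by move: Kx; rewrite KE; apply; exists Q.
    by rewrite cupE// => -[N [/Qx[//|/nclP]]].
  - by right; apply/nclP.
apply/nMK/WM/FW => Q FQ.
have [L QL nML] : exists2 L, (Q : set (smyth_power X)) L & ~ M L.
  apply: contrapT => nL; apply: (FM Q FQ) => L QL.
  by apply: contrapT => nML; apply: nL; exists L.
have [_ _ satQ] := smyth_setP Q.
by apply: satQ QL _; apply/spec_le_smyth/leK.
Qed.

(** A supremum of [F] is contained in every member of [F], hence in [U]; so the open set
    [smyth_box U] contains it and must meet [F]. *)
Lemma smyth_d_space_well_filtered (X : topologicalType) :
  kolmogorov_space X -> omega_star_d_space (smyth_power X) ->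
  omega_star_well_filtered X.
Proof.
move=> T0X [_ dX]; split=> // F U cfF oU FU.
have [|S [ubS _] SF] := dX F.
  have := cfF; rewrite -[F in countably_directed _ F]image_id.
  apply: countably_directed_image => K L _ _ KL.
  exact/spec_le_smyth.
have [||K [FK KU]] := SF (smyth_box U); first exact: smyth_box_open.
  by move=> x Sx; apply: FU => K FK; have /spec_le_smyth := ubS _ FK; apply.
by exists K.
Qed.

Theorem theorem5p12 (X : topologicalType) (hX : kolmogorov_space X) :
  (omega_star_well_filtered X <-> omega_star_d_space (smyth_power X)) /\
  (omega_star_d_space (smyth_power X) <->
   omega_star_well_filtered (smyth_power X)).
Proof.
(* The equivalences follow from the cycle (2) => (1) => (3) => (2). *)
have d_wf := smyth_d_space_well_filtered hX.
have wf_wf := @omega_star_well_filtered_smyth X.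
have wf_d := @omega_star_well_filtered_d_space (smyth_power X).
by split; split; auto.
Qed.
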